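(* Let $\mu>0$, $p\in(0,1)$, $\lambda>0$, and consider the one-dimensional $\lambda$-biased random walk on dynamical percolation $(X_t,\eta_t)_{t\ge0}$ on $\mathbb{Z}$. Then its environment process $(\xi_t)_{t\ge0}$, with state space $\{0,1\}^{E(\mathbb{Z})}$ equipped with the topology induced by the metric $d$ below, is a Feller process.
   Context: One-dimensional $\lambda$-RWDP: edges of $\mathbb{Z}$ have states $\eta_t(e)\in\{0,1\}$ ($1$ = open), initially i.i.d. Bernoulli$(p)$, each resampled as an independent Bernoulli$(p)$ at the rings of its own rate-$\mu$ Poisson clock. The walker starts at $X_0=0$, has a rate-$1$ Poisson clock and at each ring at position $x$ attempts to move to $x+1$ with probability $e^\lambda/(e^\lambda+e^{-\lambda})$ and to $x-1$ otherwise, succeeding iff the corresponding edge is open. Environment process: $\xi_t(\{x,x+1\})=\eta_t(\{X_t+x,X_t+x+1\})$ for all $x\in\mathbb{Z}$ (the environment seen from the walker). Label edges relative to the origin by $e_i=\{i-1,i\}$ for $i\ge1$ and $e_i=\{i,i+1\}$ for $i\le-1$. For $a,b\in\{0,1\}^{E(\mathbb{Z})}$ let $r(a,b)=\min\{n: a(e_n)\ne b(e_n)\text{ or }a(e_{-n})\ne b(e_{-n})\}$ and $d(a,b)=1/(1+r(a,b))$. *)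

(* Defs.v *)
From HB Require Import structures.
From mathcomp Require Import all_boot all_order all_algebra.
From mathcomp Require Import all_classical all_reals all_analysis.
Set Implicit Arguments. Unset Strict Implicit. Unset Printing Implicit Defensive.
Import Order.TTheory GRing.Theory Num.Theory numFieldNormedType.Exports.
Local Open Scope classical_set_scope.
Local Open Scope ring_scope.

(* Edges of Z.  The edge {x, x+1} is indexed by the integer x.        *)
(* A configuration in {0,1}^{E(Z)} is a map int -> bool (true = open). *)
Definition config := int -> bool.

(* Paper's labelling relative to the origin:
     e_n = {n-1, n}   (n >= 1)  -> index n-1
     e_{-n} = {-n, -n+1} (n >= 1) -> index -n                          *)
Definition edge_pos (n : nat) : int := (n%:Z - 1)%R.
Definition edge_neg (n : nat) : int := (- n%:Z)%R.

Definition differ_at (a b : config) (n : nat) : Prop :=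
  (0 < n)%N /\ (a (edge_pos n) != b (edge_pos n) \/ a (edge_neg n) != b (edge_neg n)).

Definition r_dist (a b : config) : nat :=
  xget 0%N [set n | differ_at a b n /\ (forall m, (m < n)%N -> ~ differ_at a b m)].

(* d(a,b) = 1/(1 + r(a,b)), with r = +infinity (so d = 0) when a = b *)
Definition d_metric {R : realType} (a b : config) : R :=
  if pselect (a = b) then 0 else 1 / (1 + (r_dist a b)%:R).

Definition d_continuous {R : realType} (f : config -> R) : Prop :=
  forall a (eps : R), 0 < eps -> exists2 delta : R, 0 < delta &
    forall b, d_metric a b < delta -> `|f b - f a| < eps.

(* Random ingredients (all mutually independent):                      *)
(*  EdgeTime x k : k-th inter-ring time of the rate-mu clock of edge x *)
(*  EdgeMark x k : Bernoulli(p) value (1 = open) drawn at that ring    *)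
(*  WalkTime k   : k-th inter-ring time of the walker's rate-1 clock   *)
(*  WalkDir k    : 1 (attempt right) w.p. e^l/(e^l+e^-l), else 0       *)
Inductive clock_index :=
| EdgeTime of int & nat
| EdgeMark of int & nat
| WalkTime of nat
| WalkDir of nat.

Definition ci_enc (i : clock_index) : ((int * nat) + (int * nat)) + (nat + nat) :=
  match i with
  | EdgeTime x k => inl (inl (x, k))
  | EdgeMark x k => inl (inr (x, k))
  | WalkTime k => inr (inl k)
  | WalkDir k => inr (inr k)
  end.
Definition ci_dec (c : ((int * nat) + (int * nat)) + (nat + nat)) : clock_index :=
  match c with
  | inl (inl (x, k)) => EdgeTime x k
  | inl (inr (x, k)) => EdgeMark x k
  | inr (inl k) => WalkTime k
  | inr (inr k) => WalkDir k
  end.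
Lemma ci_encK : cancel ci_enc ci_dec. Proof. by case. Qed.
HB.instance Definition _ := Equality.copy clock_index (can_type ci_encK).

Section Construction.
Variable R : realType.

Definition exp_cdf (rate s : R) : R := if s < 0 then 0 else 1 - expR (- (rate * s)).
Definition bern_cdf (q s : R) : R := if s < 0 then 0 else if s < 1 then 1 - q else 1.

Definition right_prob (lam : R) : R := expR lam / (expR lam + expR (- lam)).

Definition clock_cdf (mu p lam : R) (i : clock_index) (s : R) : R :=
  match i with
  | EdgeTime _ _ => exp_cdf mu s
  | EdgeMark _ _ => bern_cdf p s
  | WalkTime _ => exp_cdf 1 s
  | WalkDir _ => bern_cdf (right_prob lam) s
  end.

(* mutual independence + marginal laws, via joint distribution functions
   of every finite subfamily *)
Definition rwdp_clocks {dT} {T : measurableType dT} (P : probability T R)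
    (mu p lam : R) (Y : clock_index -> {RV P >-> R}) : Prop :=
  forall (s : seq clock_index) (c : clock_index -> R), uniq s ->
    P (\big[setI/setT]_(i <- s) [set w | Y i w <= c i]) =
    ((\prod_(i <- s) clock_cdf mu p lam i (c i))%R)%:E.

(* given ring times S 0 < S 1 < ..., the number of rings in [0,t] *)
Definition nrings (S : nat -> R) (t : R) : nat :=
  xget 0%N [set k | (forall j, (j < k)%N -> S j <= t) /\ t < S k].

Definition sample := clock_index -> R.

Definition edge_ring (om : sample) (x : int) (k : nat) : R :=
  \sum_(j < k.+1) om (EdgeTime x j).
Definition walk_ring (om : sample) (k : nat) : R :=
  \sum_(j < k.+1) om (WalkTime j).

Definition eta (om : sample) (eta0 : config) (t : R) : config := fun x =>
  match nrings (edge_ring om x) t with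
  | 0%N => eta0 x
  | k.+1 => om (EdgeMark x k) == 1
  end.

Fixpoint walk_pos (om : sample) (eta0 : config) (k : nat) : int :=
  match k with
  | 0%N => 0
  | k.+1 =>
    let x := walk_pos om eta0 k in
    let env := eta om eta0 (walk_ring om k) in
    if om (WalkDir k) == 1 then (if env x then x + 1 else x)
    else (if env (x - 1) then x - 1 else x)
  end%R.

Definition walker (om : sample) (eta0 : config) (t : R) : int :=
  walk_pos om eta0 (nrings (walk_ring om) t).

(* environment seen from the walker: xi_t({x,x+1}) = eta_t({X_t+x, X_t+x+1});
   since X_0 = 0, the initial environment xi_0 equals eta_0. *)
Definition env_process (om : sample) (xi0 : config) (t : R) : config :=
  fun x => eta om xi0 t (walker om xi0 t + x)%R.

Definition env_semigroup {dT} {T : measurableType dT} (P : probability T R)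
    (Y : clock_index -> {RV P >-> R}) (t : R) (f : config -> R) (xi : config) : R :=
  fine (\int[P]_w (f (env_process (fun i => Y i w) xi t))%:E).

(* Feller property (Liggett): T_t maps C(X) into C(X) and T_t f -> f pointwise as t -> 0+ *)
Definition feller {dT} {T : measurableType dT} (P : probability T R)
    (Y : clock_index -> {RV P >-> R}) : Prop :=
  forall f : config -> R, d_continuous f ->
    (forall t : R, 0 <= t -> d_continuous (env_semigroup Y t f)) /\
    (forall xi : config, (fun t => env_semigroup Y t f xi) @ (0:R)^'+ --> f xi).

End Construction.

Arguments rwdp_clocks {R dT T} P mu p lam Y.
Arguments env_semigroup {R dT T P} Y t f xi.
Arguments feller {R dT T P} Y.

(* Main.v *)
Require Import Defs.
From HB Require Import structures.
From mathcomp Require Import all_boot all_order all_algebra.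
From mathcomp Require Import all_classical all_reals all_analysis.
From mathcomp Require Import zify lra measurable_realfun.
Import Order.TTheory GRing.Theory Num.Theory numFieldNormedType.Exports.
Local Open Scope classical_set_scope.
Local Open Scope ring_scope.

Set Implicit Arguments. Unset Strict Implicit. Unset Printing Implicit Defensive.

(* Two configurations are at distance less than 1/(M+1) iff they agree on the
   edges e_{+-1}, ..., e_{+-M}.  A diagonal argument makes the configuration space
   sequentially compact, so a continuous f is bounded and, up to eps, depends only
   on finitely many edges.  The graphical construction is local: as long as the
   walker has attempted at most K steps, the environment it sees on the first M
   levels depends only on the initial configuration on the first K + M levels.
   Hence T_t f(xi) and T_t f(xi') differ by at most eps plus 2 sup|f| times the
   probability q^(K+1) that the walker's clock rings more than K times by time t,
   and T_t f(xi) - f(xi) is at most eps plus 2 sup|f| times the probability, O(t),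
   that the walker's clock or one of the 2M nearby edge clocks rings before t. *)

Definition agree (M : nat) (a b : config) :=
  forall x : int, - M%:Z <= x < M%:Z -> a x = b x.

Lemma agree_refl M a : agree M a a. Proof. by []. Qed.

Lemma agree_sym M a b : agree M a b -> agree M b a.
Proof. by move=> ab x /ab. Qed.

Lemma agree_trans M a b c : agree M a b -> agree M b c -> agree M a c.
Proof. by move=> ab bc x hx; rewrite ab // bc. Qed.

Lemma agree_le k M a b : (k <= M)%N -> agree M a b -> agree k a b.
Proof. by move=> kM ab x hx; apply: ab; lia. Qed.

Definition edge_level (x : int) : nat :=
  match x with Posz n => n.+1 | Negz n => n.+1 end.

Lemma edge_level_gt0 x : (0 < edge_level x)%N.
Proof. by case: x. Qed.

Lemma edge_level_window x M : (edge_level x <= M)%N = (- M%:Z <= x < M%:Z).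
Proof. by case: x => n /=; rewrite ?NegzE; apply/idP/idP; lia. Qed.

Lemma edge_levelP x : x = edge_pos (edge_level x) \/ x = edge_neg (edge_level x).
Proof.
case: x => n /=; [left | right]; rewrite /edge_pos /edge_neg.
  by rewrite -addn1 PoszD addrK.
by rewrite NegzE.
Qed.

Lemma edge_level_pos n : (0 < n)%N -> edge_level (edge_pos n) = n.
Proof. by case: n => // n _; rewrite /edge_pos (_ : _ - 1 = n%:Z) //; lia. Qed.

Lemma edge_level_neg n : (0 < n)%N -> edge_level (edge_neg n) = n.
Proof. by rewrite /edge_neg; case: n => // n _; rewrite NegzE. Qed.

Lemma differ_at_level a b x : a x <> b x -> differ_at a b (edge_level x).
Proof.
move=> abx; split; first exact: edge_level_gt0.
by case: (edge_levelP x) => <-; [left | right]; apply/eqP.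
Qed.

Lemma differ_at_window a b n : differ_at a b n ->
  exists2 x, - n%:Z <= x < n%:Z & a x <> b x.
Proof.
move=> [n0 [/eqP ab | /eqP ab]]; [exists (edge_pos n) | exists (edge_neg n)] => //.
  by rewrite -edge_level_window edge_level_pos.
by rewrite -edge_level_window edge_level_neg.
Qed.

Lemma r_distP a b : a <> b ->
  differ_at a b (r_dist a b) /\ forall m, (m < r_dist a b)%N -> ~ differ_at a b m.
Proof.
move=> ab; have [x abx] : exists x, a x <> b x.
  by apply/existsNP => abE; apply/ab/funext.
have ex_differ : exists n, `[< differ_at a b n >].
  by exists (edge_level x); apply/asboolP/differ_at_level.
case: (ex_minnP ex_differ) => n /asboolP abn nmin.
apply: (xgetPex 0%N
  (P := [set n | differ_at a b n /\ forall m, (m < n)%N -> ~ differ_at a b m])).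
by exists n; split => // m mn /asboolP/nmin; rewrite leqNgt mn.
Qed.

Lemma agree_d_metric {R : realType} M a b :
  agree M a b <-> d_metric a b < (M.+1%:R : R)^-1.
Proof.
rewrite /d_metric; case: pselect => [ab | ab] /=.
  by rewrite ab invr_gt0 ltr0n; split => // _; exact: agree_refl.
have [abr rmin] := r_distP ab.
rewrite div1r nat1r ltf_pV2 ?posrE ?ltr0n // ltr_nat ltnS; split => [aM | rM x xM].
  rewrite leqNgt; apply/negP => rM; have [x xr abx] := differ_at_window abr.
  by apply: abx; apply: aM; lia.
apply: contrapT => /differ_at_level; apply: rmin.
by have := edge_level_window x M; rewrite xM; lia.
Qed.

Lemma exists_natSinv_lt {R : realType} (delta : R) : 0 < delta ->
  exists M : nat, (M.+1%:R : R)^-1 < delta.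
Proof.
move=> delta0; exists (Num.truncn delta^-1).
rewrite invf_plt ?posrE ?ltr0n //.
have inv_ge0 : 0 <= delta^-1 by rewrite invr_ge0 ltW.
by case/andP: (truncn_itv inv_ge0).
Qed.

Definition infinitely_often (Q : nat -> Prop) :=
  forall N0, exists2 N, (N0 <= N)%N & Q N.

Lemma infinitely_often_bool (Q : nat -> Prop) (g : nat -> bool) :
  infinitely_often Q -> exists b, infinitely_often (fun N => Q N /\ g N = b).
Proof.
move=> Qio; apply: contrapT => /forallNP no_b.
have /existsNP[N1 /= N1max] := no_b true.
have /existsNP[N2 /= N2max] := no_b false.
have [N] := Qio (maxn N1 N2); rewrite geq_max => /andP[N1N N2N] QN.
by case gN : (g N); [apply: N1max | apply: N2max]; exists N.
Qed.

(* The values on the two edges of level [M.+1] are chosen by pigeonhole. *)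
Lemma agree_extend (c : nat -> config) M u :
  infinitely_often (fun N => agree M (c N) u) ->
  exists2 u', agree M u' u & infinitely_often (fun N => agree M.+1 (c N) u').
Proof.
move=> cu; have [b1 cub1] := infinitely_often_bool (fun N => c N M%:Z) cu.
have [b2 cub2] := infinitely_often_bool (fun N => c N (Negz M)) cub1.
pose u' x := if x == M%:Z then b1 else if x == Negz M then b2 else u x.
have u'E x : - M%:Z <= x < M%:Z -> u' x = u x.
  rewrite /u' NegzE => xM.
  by do 2 (case: eqP => [xE | _]; first by move: xM; rewrite xE; lia).
exists u' => [x /u'E // | N0].
have [N N0N [[cNu cNb1] cNb2]] := cub2 N0; exists N => // x xM.
rewrite /u'; case: eqP => [-> // | /eqP xM1]; case: eqP => [-> // | /eqP xM2].
by apply: cNu; move: xM xM1 xM2; rewrite NegzE; lia.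
Qed.

Lemma config_cluster (c : nat -> config) :
  exists c0, forall M, infinitely_often (fun N => agree M (c N) c0).
Proof.
have step (Mu : nat * config) : exists u',
    agree Mu.1 u' Mu.2 /\
    (infinitely_often (fun N => agree Mu.1 (c N) Mu.2) ->
     infinitely_often (fun N => agree Mu.1.+1 (c N) u')).
  case: Mu => M u /=.
  have [cu | ncu] := pselect (infinitely_often (fun N => agree M (c N) u)).
    by have [u' u'u cu'] := agree_extend cu; exists u'.
  by exists u; split => [|/ncu].
have [next nextP] := choice step.
pose u := nat_rec (fun _ => config) (fun _ => false) (fun M uM => next (M, uM)).
have cu M : infinitely_often (fun N => agree M (c N) (u M)).
  elim: M => [N0 | M IH]; first by exists N0 => // x; lia.
  exact: (nextP (M, u M)).2.
have u_agree M k : (k <= M)%N -> agree k (u M) (u k).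
  elim: M => [|M IH]; first by rewrite leqn0 => /eqP ->; exact: agree_refl.
  rewrite leq_eqVlt => /orP[/eqP -> | ]; first exact: agree_refl.
  rewrite ltnS => kM; apply: agree_trans (IH kM).
  exact: agree_le kM (nextP (M, u M)).1.
exists (fun x => u (edge_level x) x) => M N0.
have [N N0N cNu] := cu M N0; exists N => // x xM; rewrite cNu //.
have xl : (edge_level x <= M)%N by rewrite edge_level_window.
by apply: u_agree xl _ _; rewrite -edge_level_window.
Qed.

Lemma d_continuous_uniform {R : realType} (f : config -> R) : d_continuous f ->
  forall eps : R, 0 < eps -> exists M, forall a b, agree M a b -> `|f a - f b| < eps.
Proof.
move=> fc eps eps0; apply: contrapT => /forallNP no_M.
have far M : exists ab : config * config,
    agree M ab.1 ab.2 /\ eps <= `|f ab.1 - f ab.2|.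
  have /existsNP[a /existsNP[b /not_implyP[ab fab]]] := no_M M.
  by exists (a, b); split => //; rewrite leNgt; apply/negP.
have [s sP] := choice far.
have [c0 c0P] := config_cluster (fun N => (s N).1).
have [delta delta0 fc0] := fc c0 (eps / 2) (divr_gt0 eps0 (ltr0Sn _ 1)).
have [K Kdelta] := exists_natSinv_lt delta0.
have near_c0 a : agree K a c0 -> `|f a - f c0| < eps / 2.
  by move=> /agree_sym/agree_d_metric aK; apply: fc0; apply: lt_trans Kdelta.
have [N KN s1c0] := c0P K K; have [s12 fs12] := sP N.
have s2c0 : agree K (s N).2 c0 by apply: agree_trans s1c0; exact/agree_sym/(agree_le KN).
move: fs12; rewrite leNgt => /negP; apply.
have -> : f (s N).1 - f (s N).2 = (f (s N).1 - f c0) - (f (s N).2 - f c0).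
  by rewrite opprB addrA subrK.
rewrite (splitr eps).
by apply: le_lt_trans (ler_normB _ _) (ltrD (near_c0 _ s1c0) (near_c0 _ s2c0)).
Qed.

Lemma d_continuous_bounded {R : realType} (f : config -> R) : d_continuous f ->
  exists B, forall a, `|f a| <= B.
Proof.
move=> fc; apply: contrapT => /forallNP no_B.
have large N : exists a, N%:R < `|f a|.
  by have /existsNP[a fa] := no_B N%:R; exists a; rewrite ltNge; apply/negP.
have [s sP] := choice large.
have [c0 c0P] := config_cluster s.
have [delta delta0 fc0] := fc c0 1 ltr01.
have [K Kdelta] := exists_natSinv_lt delta0.
have [N KN sc0] := c0P K (Num.truncn (`|f c0| + 1)).+1.
have /fc0 fsN : d_metric c0 (s N) < delta.
  by apply: lt_trans Kdelta; exact/agree_d_metric/agree_sym.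
have := sP N; rewrite ltNge => /negP; apply.
have /andP[_ /ltW f1] := truncn_itv (addr_ge0 (normr_ge0 (f c0)) ler01).
have fsN_le : `|f (s N)| <= `|f c0| + 1.
  rewrite -(subrK (f c0) (f (s N))) addrC; apply: le_trans (ler_normD _ _) _.
  by rewrite lerD2l ltW.
by apply: le_trans fsN_le (le_trans f1 _); rewrite ler_nat.
Qed.

Section Locality.
Variable R : realType.
Implicit Types (S : nat -> R) (t : R) (om : sample R) (a b : config).

Definition ring_count S t k := (forall j, (j < k)%N -> S j <= t) /\ t < S k.

Lemma ring_count_uniq S t k k' : ring_count S t k -> ring_count S t k' -> k = k'.
Proof.
move=> [Sk tk] [Sk' tk']; apply/eqP; rewrite eqn_leq.
by apply/andP; split; rewrite leqNgt; apply/negP;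
  [move=> /Sk; rewrite leNgt tk' | move=> /Sk'; rewrite leNgt tk].
Qed.

Lemma nringsE S t k : ring_count S t k -> nrings S t = k.
Proof.
move=> tk; have tnr := xgetPex 0%N (P := [set k | ring_count S t k]) (ex_intro _ k tk).
exact: ring_count_uniq tnr tk.
Qed.

Lemma nrings_cases S t :
  ring_count S t (nrings S t) \/ (nrings S t = 0%N /\ forall k, ~ ring_count S t k).
Proof.
have [[k tk] | no_k] := pselect (exists k, ring_count S t k).
  by left; rewrite (nringsE tk).
right; split => [|k tk]; last by apply: no_k; exists k.
by apply: xgetPN => k tk; apply: no_k; exists k.
Qed.

Lemma nrings_le S t K : t < S K -> (nrings S t <= K)%N.
Proof.
move=> tK; case: (nrings_cases S t) => [[St _] | [-> _]] //.
by rewrite leqNgt; apply/negP => /St; rewrite leNgt tK.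
Qed.

Lemma eta_local om a b t y : a y = b y -> Defs.eta om a t y = Defs.eta om b t y.
Proof. by rewrite /Defs.eta => ->. Qed.

Lemma walk_pos_bound om a k : - k%:Z <= walk_pos om a k <= k%:Z.
Proof.
elim: k => [|k IH] //=; move: IH => /andP[IH1 IH2].
by repeat case: ifP => _; apply/andP; split; lia.
Qed.

Lemma walk_pos_local om a b L k : agree L a b -> (k <= L)%N ->
  walk_pos om a k = walk_pos om b k.
Proof.
move=> ab; elim: k => [|k IH] // kL /=; rewrite IH; last exact: ltnW.
have /andP[lb ub] := walk_pos_bound om b k.
by rewrite !(@eta_local om a b) //; apply: ab; lia.
Qed.

(* By time [t] the walker has attempted [nrings (walk_ring om) t] steps, each
   moving it by at most one edge. *)
Lemma env_process_local om a b t L M : agree L a b ->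
  (nrings (walk_ring om) t + M <= L)%N ->
  agree M (env_process om a t) (env_process om b t).
Proof.
move=> ab tML x xM; rewrite /env_process /walker.
rewrite (walk_pos_local _ ab); last exact: leq_trans (leq_addr M _) tML.
have /andP[lb ub] := walk_pos_bound om b (nrings (walk_ring om) t).
by apply/eta_local/ab; lia.
Qed.

Lemma env_process_before_rings om a t M : t < om (WalkTime 0) ->
  (forall x : int, - M%:Z <= x < M%:Z -> t < om (EdgeTime x 0)) ->
  agree M (env_process om a t) a.
Proof.
move=> walk_t edge_t x xM; rewrite /env_process /walker.
rewrite (@nringsE _ _ 0) /=; last by split; rewrite // /walk_ring big_ord1.
rewrite add0r /Defs.eta (@nringsE _ _ 0) //.
by split; rewrite // /edge_ring big_ord1; apply: edge_t.
Qed.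

End Locality.

Section Measurability.
Variables (R : realType) (dT : measure_display) (T : measurableType dT).

Definition fiber_measurable {A : eqType} (u : T -> A) :=
  forall y, measurable_fun [set: T] (fun w => u w == y).

Lemma measurable_fun_boolE (b : T -> bool) :
  measurable_fun [set: T] b <-> measurable [set w | b w].
Proof.
split => [mb | mB]; first by rewrite -[X in measurable X]setTI; exact: mb.
by apply: (measurable_fun_bool true); rewrite setTI.
Qed.

Lemma fiber_measurable_boolE (b : T -> bool) :
  fiber_measurable b <-> measurable_fun [set: T] b.
Proof.
have eqbE c : (fun w => b w == c) = if c then b else negb \o b.
  by case: c; apply/funext => w /=; case: (b w).
split => [/(_ true) | mb c]; first by rewrite eqbE.
by rewrite eqbE; case: c => //; exact: measurable_neg.
Qed.

Lemma fiber_measurable_cst {A : eqType} (y0 : A) : fiber_measurable (fun=> y0).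
Proof. by move=> y; exact: measurable_cst. Qed.

Lemma fiber_measurable_if {A : eqType} (b : T -> bool) (u v : T -> A) :
  measurable_fun [set: T] b -> fiber_measurable u -> fiber_measurable v ->
  fiber_measurable (fun w => if b w then u w else v w).
Proof.
move=> mb mu mv y; rewrite (_ : (fun w => _) = fun w => if b w then u w == y else v w == y).
  exact: measurable_fun_ifT.
by apply/funext => w; case: (b w).
Qed.

Lemma fiber_measurable_comp {I : countType} {A : eqType} (n : T -> I) (u : I -> T -> A) :
  fiber_measurable n -> (forall i, fiber_measurable (u i)) ->
  fiber_measurable (fun w => u (n w) w).
Proof.
move=> mn mu y; apply/measurable_fun_boolE.
rewrite (_ : [set w | _] = \bigcup_i ([set w | n w == i] `&` [set w | u i w == y])).
  apply: countable_bigcupT_measurable => [|i]; first exact: countableP.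
  by apply: measurableI; apply/measurable_fun_boolE; [exact: mn | exact: mu].
apply/seteqP; split => w /= => [uy | [i _ [/eqP <-]] //].
by exists (n w) => //=; split.
Qed.

Lemma fiber_measurable_nrings (S : nat -> T -> R) (tau : T -> R) :
  (forall j, measurable_fun [set: T] (S j)) -> measurable_fun [set: T] tau ->
  fiber_measurable (fun w => nrings (S^~ w) (tau w)).
Proof.
move=> mS mtau.
have m_count k : measurable [set w | ring_count (S^~ w) (tau w) k].
  apply: measurableI; last exact/measurable_fun_boolE/measurable_fun_ltr.
  by apply: bigcap_measurableType => j _; exact/measurable_fun_boolE/measurable_fun_ler.
move=> k; apply/measurable_fun_boolE.
rewrite (_ : [set w | _] = [set w | ring_count (S^~ w) (tau w) k] `|`
    ([set _ | k == 0%N] `&` ~` \bigcup_j [set w | ring_count (S^~ w) (tau w) j])).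
  apply: measurableU => //; apply: measurableI.
    exact/measurable_fun_boolE/measurable_cst.
  by apply: measurableC; exact: bigcupT_measurable.
apply/seteqP; split => w /= => [/eqP <- | ].
  case: (nrings_cases (S^~ w) (tau w)) => [nr | [-> no_k]]; first by left.
  by right; split => // -[j _ /no_k].
case=> [/nringsE -> // | [/eqP -> no_k]]; apply/eqP.
case: (nrings_cases (S^~ w) (tau w)) => [nr | [] //].
by case: no_k; exists (nrings (S^~ w) (tau w)).
Qed.

Variable Y : clock_index -> T -> R.
Hypothesis mY : forall i, measurable_fun [set: T] (Y i).
Let om (w : T) : sample R := fun i => Y i w.

Lemma measurable_edge_ring x k : measurable_fun [set: T] (fun w => edge_ring (om w) x k).
Proof. by apply: measurable_sum => j; exact: mY. Qed.

Lemma measurable_walk_ring k : measurable_fun [set: T] (fun w => walk_ring (om w) k).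
Proof. by apply: measurable_sum => j; exact: mY. Qed.

Lemma fiber_measurable_eta a (tau : T -> R) x : measurable_fun [set: T] tau ->
  fiber_measurable (fun w => Defs.eta (om w) a (tau w) x).
Proof.
move=> mtau; pose state k w := if k is k'.+1 then Y (EdgeMark x k') w == 1 else a x.
apply: (@fiber_measurable_comp _ _ (fun w => nrings (edge_ring (om w) x) (tau w)) state).
  by apply: fiber_measurable_nrings => // j; exact: measurable_edge_ring.
case=> [|k]; first exact: fiber_measurable_cst.
by apply/fiber_measurable_boolE/measurable_fun_eqr.
Qed.

Lemma fiber_measurable_walk_pos a k : fiber_measurable (fun w => walk_pos (om w) a k).
Proof.
have m_env k' y :
    measurable_fun [set: T] (fun w => Defs.eta (om w) a (walk_ring (om w) k') y).
  exact/fiber_measurable_boolE/fiber_measurable_eta/measurable_walk_ring.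
elim: k => [|k IH]; first exact: fiber_measurable_cst.
pose step z w := let env := Defs.eta (om w) a (walk_ring (om w) k) in
  if Y (WalkDir k) w == 1 then (if env z then z + 1 else z)
  else (if env (z - 1) then z - 1 else z).
apply: (@fiber_measurable_comp _ _ _ step IH) => z.
by apply: fiber_measurable_if; [exact: measurable_fun_eqr
  | apply: fiber_measurable_if; [exact: m_env | exact: fiber_measurable_cst ..] ..].
Qed.

Lemma measurable_env_process a t x :
  measurable_fun [set: T] (fun w => env_process (om w) a t x).
Proof.
apply/fiber_measurable_boolE.
apply: (@fiber_measurable_comp _ _ (fun w => walker (om w) a t)
  (fun z w => Defs.eta (om w) a t (z + x))) => [|z].
  apply: (@fiber_measurable_comp _ _ (fun w => nrings (walk_ring (om w)) t)
    (fun k w => walk_pos (om w) a k)) => [|k].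
    by apply: fiber_measurable_nrings => // j; exact: measurable_walk_ring.
  exact: fiber_measurable_walk_pos.
exact: fiber_measurable_eta.
Qed.

End Measurability.

Definition window (N : nat) : seq int := [seq i%:Z - N%:Z | i <- iota 0 (N + N)].

Lemma mem_window N y : (y \in window N) = (- N%:Z <= y < N%:Z).
Proof.
apply/mapP/idP => [[i] | yN]; first by rewrite mem_iota => /andP[_ iN] ->; lia.
by exists (absz (y + N%:Z)); [rewrite mem_iota; apply/andP; split | ]; lia.
Qed.

Lemma size_window N : size (window N) = (N + N)%N.
Proof. by rewrite size_map size_iota. Qed.

Definition truncate (N : nat) (c : config) : config :=
  fun y => if y \in window N then c y else false.

Lemma agree_truncate N c : agree N (truncate N c) c.
Proof. by move=> y yN; rewrite /truncate mem_window yN. Qed.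

Definition update (c : config) (x : int) (b : bool) : config :=
  fun y => if y == x then b else c y.

Section ContinuousObservables.
Variables (R : realType) (dT : measure_display) (T : measurableType dT).
Variable e : T -> config.
Hypothesis me : forall x, measurable_fun [set: T] (fun w => e w x).

Lemma measurable_fun_local (L : seq int) (h : config -> R) :
  (forall c c', {in L, c =1 c'} -> h c = h c') ->
  measurable_fun [set: T] (fun w => h (e w)).
Proof.
elim: L h => [|x L IH] h hL.
  rewrite (_ : (fun w => _) = fun=> h (fun=> false)); first exact: measurable_cst.
  by apply/funext => w; apply: hL.
have hLx b : forall c c', {in L, c =1 c'} -> h (update c x b) = h (update c' x b).
  move=> c c' cc'; apply: hL => y; rewrite /update in_cons.
  by case: eqP => //= _ /cc'.
rewrite (_ : (fun w => _) = fun w =>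
    if e w x then h (update (e w) x true) else h (update (e w) x false)).
  apply: measurable_fun_ifT => //.
    exact: (IH (fun c => h (update c x true))) (hLx true).
  exact: (IH (fun c => h (update c x false))) (hLx false).
apply/funext => w; case ewx : (e w x); apply: hL => y _; rewrite /update;
  by case: eqP => // ->.
Qed.

Lemma measurable_fun_d_continuous (f : config -> R) : d_continuous f ->
  measurable_fun [set: T] (fun w => f (e w)).
Proof.
move=> fc; apply: (measurable_fun_cvg (h := fun N w => f (truncate N (e w)))).
  move=> N; apply: (measurable_fun_local (L := window N) (h := f \o truncate N)).
  move=> c c' cc' /=; congr f; apply/funext => y; rewrite /truncate.
  by case: ifP => // /cc'.
move=> w _; apply/cvgrPdist_lt => eps eps0.
have [delta delta0 fc_w] := fc (e w) eps eps0.
have [M Mdelta] := exists_natSinv_lt delta0.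
exists M => // N /= MN; rewrite distrC; apply: fc_w.
apply: lt_trans Mdelta; apply/agree_d_metric/agree_sym.
exact: agree_le MN (agree_truncate (e w)).
Qed.

End ContinuousObservables.

Section BoundedIntegrals.
Variables (R : realType) (dT : measure_display) (T : measurableType dT).
Variable P : probability T R.

Lemma Rintegral_prob_cst (c : R) : Rintegral P [set: T] (fun=> c) = c.
Proof. by rewrite Rintegral_cst //; have /= -> := probability_setT P; rewrite mulr1. Qed.

Lemma integrable_bounded (k : T -> R) (C : R) : measurable_fun [set: T] k ->
  (forall w, `|k w| <= C) -> P.-integrable [set: T] (EFin \o k).
Proof.
move=> mk kC; apply: measurable_bounded_integrable => //.
  by have /= -> := probability_setT P; rewrite ltry.
by exists C; split; [exact: num_real | move=> M CM w _; exact: le_trans (kC w) (ltW CM)].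
Qed.

Lemma fine_measure_le (A : set T) (c : R) : measurable A -> (P A <= c%:E)%E ->
  fine (P A) <= c.
Proof. by move=> mA; rewrite -lee_fin fineK //; exact: fin_num_measure. Qed.

Lemma measure_bigsetU_le (I : Type) (s : seq I) (F : I -> set T) :
  (forall i, measurable (F i)) ->
  (P (\big[setU/set0]_(i <- s) F i) <= \sum_(i <- s) P (F i))%E.
Proof.
move=> mF; elim: s => [|i s IH]; first by rewrite !big_nil measure0.
rewrite !big_cons; apply: le_trans (measureU2 _ _ _) (leeD _ IH) => //.
exact: bigsetU_measurable.
Qed.

Lemma Rintegral_dist_le (g h : T -> R) (B a : R) (Bad : set T) :
  measurable_fun [set: T] g -> measurable_fun [set: T] h ->
  (forall w, `|g w| <= B) -> (forall w, `|h w| <= B) -> measurable Bad ->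
  (forall w, ~ Bad w -> `|g w - h w| <= a) -> 0 <= a ->
  `|Rintegral P [set: T] g - Rintegral P [set: T] h| <= a + 2 * B * fine (P Bad).
Proof.
move=> mg mh gB hB mBad gh_a a0.
have mgh : measurable_fun [set: T] (fun w => g w - h w) by exact: measurable_funB.
have ghB w : `|g w - h w| <= B + B by exact: le_trans (ler_normB _ _) (lerD (gB w) (hB w)).
have indic_le1 w : `|\1_Bad w : R| <= 1.
  by rewrite /indic; case: (w \in Bad); rewrite ?normr1 ?normr0.
have m_indic : measurable_fun [set: T] (\1_Bad : T -> R) by exact: measurable_indic.
have i_indic := integrable_bounded m_indic indic_le1.
have i_a := integrable_bounded (measurable_cst a) (fun _ => lexx `|a|).
have m_2B : measurable_fun [set: T] (fun w => 2 * B * (\1_Bad w : R)).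
  exact: measurable_funM.
have i_2B : P.-integrable [set: T] (EFin \o fun w => 2 * B * (\1_Bad w : R)).
  apply: (integrable_bounded (C := `|2 * B|)) => // w.
  by rewrite normrM ler_piMr.
have i_bound := integrableD measurableT i_a i_2B.
rewrite -RintegralB ?(integrable_bounded _ gB) ?(integrable_bounded _ hB) //.
apply: le_trans (le_normr_Rintegral measurableT (integrable_bounded mgh ghB)) _.
apply: le_trans (le_Rintegral measurableT _ i_bound _) _.
- apply: (integrable_bounded (C := B + B)); first exact: measurableT_comp.
  by move=> w; rewrite normr_id.
- move=> w _; rewrite /indic; case: (boolP (w \in Bad)) => [_ | /negP wBad].
    by apply: le_trans (ghB w) _; rewrite /= mulr1; lra.
  by rewrite /= mulr0 addr0 gh_a //; apply: contra_not wBad; exact: mem_set.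
rewrite RintegralD // Rintegral_prob_cst lerD2l.
by rewrite RintegralZl // /Rintegral integral_indic // setIT.
Qed.

Lemma Rintegral_dist_lt (g h : T -> R) (B eps : R) (Bad : set T) :
  measurable_fun [set: T] g -> measurable_fun [set: T] h -> 0 <= B ->
  (forall w, `|g w| <= B) -> (forall w, `|h w| <= B) -> measurable Bad ->
  (forall w, ~ Bad w -> `|g w - h w| <= eps / 2) ->
  fine (P Bad) * (2 * B + 1) < eps / 2 ->
  `|Rintegral P [set: T] g - Rintegral P [set: T] h| < eps.
Proof.
move=> mg mh B0 gB hB mBad gh_eps Bad_small.
have P0 : 0 <= fine (P Bad) by exact/fine_ge0/measure_ge0.
have eps0 : 0 < eps / 2 by apply: le_lt_trans Bad_small; apply: mulr_ge0 => //; lra.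
apply: le_lt_trans (Rintegral_dist_le mg mh gB hB mBad gh_eps (ltW eps0)) _.
by rewrite {2}(splitr eps) ltrD2l; apply: le_lt_trans Bad_small; nra.
Qed.

End BoundedIntegrals.

Section ClockLaws.
Variable R : realType.

Lemma clock_cdf_neg (mu p lam : R) i c : c < 0 -> clock_cdf mu p lam i c = 0.
Proof. by move=> c0; case: i => * /=; rewrite /exp_cdf /bern_cdf c0. Qed.

Lemma exp_cdf_ge0 (r s : R) : 0 <= r -> 0 <= exp_cdf r s.
Proof.
move=> r0; rewrite /exp_cdf; case: ltP => // s0.
by rewrite subr_ge0 expR_le1 oppr_le0 mulr_ge0.
Qed.

Lemma exp_cdf_lt1 (r s : R) : exp_cdf r s < 1.
Proof. by rewrite /exp_cdf; case: ifP => _; rewrite ?ltr01 // ltrBlDr ltrDl expR_gt0. Qed.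

Lemma exp_cdf_le (r s : R) : 0 <= s -> exp_cdf r s <= r * s.
Proof.
move=> s0; rewrite /exp_cdf ltNge s0 /=.
by have := expR_ge1Dx (- (r * s)); lra.
Qed.

End ClockLaws.

Section Clocks.
Variables (R : realType) (dT : measure_display) (T : measurableType dT).
Variables (P : probability T R) (mu p lam : R) (Y : clock_index -> {RV P >-> R}).
Hypothesis HY : rwdp_clocks P mu p lam Y.

Let om (w : T) : sample R := fun i => Y i w.

Lemma measurable_clock_le i c : measurable [set w | Y i w <= c].
Proof. exact/measurable_fun_boolE/measurable_fun_ler. Qed.

Lemma measurable_clock_lt i c : measurable [set w | Y i w < c].
Proof. exact/measurable_fun_boolE/measurable_fun_ltr. Qed.

Lemma clock_cdfE i c : P [set w | Y i w <= c] = (clock_cdf mu p lam i c)%:E.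
Proof.
by have := HY (fun=> c) (erefl : uniq [:: i]); rewrite !big_cons !big_nil setIT mulr1.
Qed.

Lemma clock_lt0 i : P [set w | Y i w < 0] = 0%E.
Proof.
have -> : [set w | Y i w < 0] = \bigcup_n [set w | Y i w <= - n.+1%:R^-1].
  apply/seteqP; split => w /= => [Yw0 | [n _ /= Ywn]].
    have [n ninv] : exists n : nat, n.+1%:R^-1 < - Y i w.
      by apply: exists_natSinv_lt; rewrite oppr_gt0.
    by exists n => //=; rewrite lerNr ltW.
  by apply: le_lt_trans Ywn _; rewrite oppr_lt0 invr_gt0.
apply/negligibleP; first by apply: bigcupT_measurable => n; exact: measurable_clock_le.
apply: negligible_bigcup => n; apply/negligibleP; first exact: measurable_clock_le.
by apply: eq_trans (clock_cdfE _ _) _; rewrite clock_cdf_neg // oppr_lt0 invr_gt0.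
Qed.

Lemma prob_clock_le i c (d : R) : clock_cdf mu p lam i c <= d ->
  (P [set w | (Y i w <= c)%R] <= d%:E)%E.
Proof. by rewrite clock_cdfE lee_fin. Qed.

(* The walker's clock rings more than [K] times by [t] only if its first [K.+1]
   inter-ring times are all at most [t] (independent events) or one is negative
   (a null event). *)
Lemma walk_rings_le t K : exists Bad : set T,
  [/\ measurable Bad, fine (P Bad) <= exp_cdf 1 t ^+ K.+1 &
      forall w, ~ Bad w -> (nrings (walk_ring (om w)) t <= K)%N].
Proof.
pose s := index_iota 0 K.+1.
pose Many := \big[setI/setT]_(i <- map WalkTime s) [set w | Y i w <= t].
pose Neg := \big[setU/set0]_(j <- s) [set w | Y (WalkTime j) w < 0].
have mMany : measurable Many.
  by apply: bigsetI_measurable => j _; exact: measurable_clock_le.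
have mNeg : measurable Neg.
  by apply: bigsetU_measurable => j _; exact: measurable_clock_lt.
exists (Many `|` Neg); split => [| | w].
- exact: measurableU.
- apply: fine_measure_le; first exact: measurableU.
  apply: le_trans (measureU2 _ mMany mNeg) _; rewrite -[X in (_ <= X)%E]adde0 leeD //.
    have uniq_s : uniq (map WalkTime s) by rewrite map_inj_uniq ?iota_uniq // => ? ? [].
    rewrite le_eqVlt; apply/orP; left; apply/eqP/(eq_trans (HY (fun=> t) uniq_s)).
    by rewrite big_map prodr_const_nat subn0.
  apply: le_trans (measure_bigsetU_le _ _ (fun j => measurable_clock_lt _ 0)) _.
  by rewrite big1 // => j _; exact: clock_lt0.
- rewrite /Many /Neg big_map -bigcap_seq -bigcup_seq.
  move=> /not_orP[/existsNP[j /not_implyP[/= js /negP]]]; rewrite -ltNge => tY noNeg.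
  have Y_ge0 k : (k < K.+1)%N -> 0 <= Y (WalkTime k) w.
    move=> kK; rewrite leNgt; apply/negP => Yk.
    by apply: noNeg; exists k; rewrite /= ?mem_index_iota.
  have jK : (j < K.+1)%N by move: js; rewrite mem_index_iota.
  apply: nrings_le; rewrite /walk_ring (bigD1 (Ordinal jK)) //=.
  by rewrite (lt_le_trans tY) // lerDl sumr_ge0 // => k _; exact: Y_ge0.
Qed.

(* Off [Bad] neither the walker's clock nor those of the [M + M] edges of the
   window ring before [t]; each rings with probability at most [rate * t]. *)
Lemma early_rings_le t M : 0 <= t -> exists Bad : set T,
  [/\ measurable Bad, fine (P Bad) <= t * (1 + (M + M)%:R * mu) &
      forall a w, ~ Bad w -> agree M (env_process (om w) a t) a].
Proof.
move=> t0; pose Edge := \big[setU/set0]_(x <- window M) [set w | Y (EdgeTime x 0) w <= t].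
have mEdge : measurable Edge.
  by apply: bigsetU_measurable => x _; exact: measurable_clock_le.
have mBad : measurable ([set w | Y (WalkTime 0) w <= t] `|` Edge).
  by apply: measurableU => //; exact: measurable_clock_le.
exists ([set w | Y (WalkTime 0) w <= t] `|` Edge); split => [// | | a w].
- apply: fine_measure_le => //.
  apply: le_trans (measureU2 _ (measurable_clock_le _ _) mEdge) _.
  rewrite mulrDr mulr1 EFinD leeD //.
    by apply: prob_clock_le; rewrite /= -[t in _ <= t]mul1r exp_cdf_le.
  apply: le_trans (measure_bigsetU_le _ _ (fun x => measurable_clock_le _ _)) _.
  apply: (@le_trans _ _ (\sum_(x <- window M) (mu * t)%:E)%E).
    by apply: lee_sum => x _; apply: prob_clock_le; exact: exp_cdf_le.
  rewrite sumEFin big_const_seq count_predT size_window iter_addr_0 lee_fin.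
  by rewrite -mulr_natl; nra.
- move=> wBad; apply: env_process_before_rings => [|x xM]; rewrite ltNge;
    apply/negP => Yt; apply: wBad; [by left | right].
  by rewrite /Edge -bigcup_seq; exists x; rewrite //= mem_window.
Qed.

Lemma measurable_observable (f : config -> R) xi t : d_continuous f ->
  measurable_fun [set: T] (fun w => f (env_process (om w) xi t)).
Proof.
by move=> fc; apply: measurable_fun_d_continuous fc => x; exact: measurable_env_process.
Qed.

Lemma env_semigroup_continuous (f : config -> R) t : d_continuous f -> 0 <= t ->
  d_continuous (env_semigroup Y t f).
Proof.
move=> fc t0 xi eps eps0; have eps2 : 0 < eps / 2 by rewrite divr_gt0.
have [B fB] := d_continuous_bounded fc; have B0 := le_trans (normr_ge0 _) (fB xi).
have B1 : 0 < 2 * B + 1 by lra.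
have [M fM] := d_continuous_uniform fc eps2.
pose q := exp_cdf 1 t; have q0 : 0 <= q by exact: exp_cdf_ge0.
have [K qK] : exists K, q ^+ K.+1 * (2 * B + 1) < eps / 2.
  have /cvgrPdist_lt/(_ (eps / 2 / (2 * B + 1))) : q ^+ n @[n --> \oo] --> 0.
    by apply: cvg_expr; rewrite ger0_norm ?exp_cdf_lt1.
  case=> [|N _ qN]; first by rewrite !divr_gt0.
  exists N; rewrite -ltr_pdivlMr //.
  by have := qN N.+1 (leqnSn N); rewrite sub0r normrN ger0_norm ?exprn_ge0.
have [Bad [mBad PBad Bad_rings]] := walk_rings_le t K.
exists (K + M).+1%:R^-1; first by rewrite invr_gt0 ltr0n.
move=> xi' /agree_d_metric xi_xi'.
apply: (Rintegral_dist_lt (measurable_observable _ _ fc) (measurable_observable _ _ fc)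
  B0 (fun w => fB _) (fun w => fB _) mBad).
  move=> w /Bad_rings wK; apply/ltW/fM/(env_process_local (agree_sym xi_xi')).
  by rewrite leq_add2r.
exact: le_lt_trans (ler_wpM2r (ltW B1) PBad) qK.
Qed.

Lemma env_semigroup_cvg0 (f : config -> R) xi : 0 < mu -> d_continuous f ->
  env_semigroup Y t f xi @[t --> 0^'+] --> f xi.
Proof.
move=> mu0 fc; apply/cvgrPdist_lt => eps eps0; have eps2 : 0 < eps / 2 by rewrite divr_gt0.
have [B fB] := d_continuous_bounded fc; have B0 := le_trans (normr_ge0 _) (fB xi).
have [M fM] := d_continuous_uniform fc eps2.
pose A := (1 + (M + M)%:R * mu) * (2 * B + 1).
have Mmu : 0 <= (M + M)%:R * mu by rewrite mulr_ge0 // ltW.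
have A0 : 0 < A by apply: mulr_gt0; lra.
near=> t.
have t0 : 0 < t by near: t; exact: nbhs_right_gt.
have tA : t * A < eps / 2.
  by rewrite -ltr_pdivlMr //; near: t; apply: nbhs_right_lt; rewrite divr_gt0.
have [Bad [mBad PBad early]] := early_rings_le M (ltW t0).
rewrite distrC -[X in _ - X](Rintegral_prob_cst P (f xi)).
apply: (Rintegral_dist_lt (measurable_observable _ _ fc) (measurable_cst (f xi))
  B0 (fun w => fB _) (fun w => fB _) mBad).
  by move=> w /(early xi) /fM /ltW.
by apply: le_lt_trans tA; rewrite mulrA ler_wpM2r //; lra.
Unshelve. all: by end_near.
Qed.

End Clocks.

Theorem lemma3p2 (R : realType) (dT : measure_display) (T : measurableType dT)
    (P : probability T R) (mu p lam : R)
    (Y : clock_index -> {RV P >-> R}) :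
  0 < mu -> 0 < p < 1 -> 0 < lam ->
  rwdp_clocks P mu p lam Y ->
  feller Y.
Proof.
move=> mu0 _ _ HY f fc; split => [t t0 | xi].
  exact (env_semigroup_continuous HY fc t0).
exact (env_semigroup_cvg0 HY mu0 fc).
Qed.
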